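(* Let $\mathbf{CbUMet}$ be the category of complete 1-bounded ultrametric spaces and nonexpansive maps, and let $T$ be Escardó's metric lifting monad on it. Then $T$ is guarded iterative when a morphism $f\colon X\to TY$ is declared $\sigma$-guarded (for a summand $\sigma$ of $Y$) iff for all $x$ and $y$, $f(x)=(\sigma(y),k)$ implies $k>0$.
   Context: For $(A,d)$ in $\mathbf{CbUMet}$, $T(A,d)=((A\times\mathbb N)\cup\{\infty\},d')$ with $d'(\infty,\infty)=0$, $d'((x,k),\infty)=d'(\infty,(x,k))=(1/2)^k$, $d'((x,k),(y,k))=(1/2)^k d(x,y)$, and $d'((x,k),(y,t))=(1/2)^{\min(k,t)}$ for $k\neq t$. Unit $\eta(a)=(a,0)$; Kleisli lifting of $f\colon A\to TB$: $f^*(a,k)=(b,k+t)$ where $f(a)=(b,t)$, $f^*(a,k)=\infty$ if $f(a)=\infty$, and $f^*(\infty)=\infty$. Coproducts in $\mathbf{CbUMet}$ are disjoint unions with distance 1 between the two parts. A summand $\sigma$ of $Y$ is a coproduct injection (with complement). Guarded iterative means: the relation satisfies (trv) $T(\mathrm{inl})\circ f\colon X\to_{\mathrm{inr}}T(Y+Z)$; (par) $f\colon X\to_\sigma TZ$, $g\colon Y\to_\sigma TZ$ imply $[f,g]\colon X+Y\to_\sigma TZ$; (cmp) $f\colon X\to_{\mathrm{inr}}T(Y+Z)$, $g\colon Y\to_\sigma TV$, $h\colon Z\to TV$ imply $[g,h]^*\circ f\colon X\to_\sigma TV$; and every $f\colon X\to_{\mathrm{inr}}T(Y+X)$ has a unique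 $f^\dagger\colon X\to TY$ with $f^\dagger=[\eta,f^\dagger]^*\circ f$. *)

(* Defs.v *)
From Stdlib Require Import Reals Lra Lia Arith Classical.
From Stdlib Require Import FunctionalExtensionality ProofIrrelevance.

Set Implicit Arguments.
Unset Strict Implicit.

Open Scope R_scope.

Record Category := {
  Ob :> Type;
  Hom : Ob -> Ob -> Type;
  idm : forall A, Hom A A;
  cmp : forall A B C, Hom B C -> Hom A B -> Hom A C;
  cmp_idl : forall A B (f : Hom A B), cmp (idm B) f = f;
  cmp_idr : forall A B (f : Hom A B), cmp f (idm A) = f;
  cmp_assoc : forall A B C D (h : Hom C D) (g : Hom B C) (f : Hom A B),
    cmp h (cmp g f) = cmp (cmp h g) f }.

Arguments Hom {c} A B.
Arguments idm {c} A.
Arguments cmp {c A B C} g f.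

Declare Scope cat_scope.
Delimit Scope cat_scope with cat.
Notation "g '\oc' f" := (cmp g f) (at level 40, left associativity) : cat_scope.
Open Scope cat_scope.

Definition is_coproduct (C : Category) (A B Y : C)
    (s : Hom A Y) (t : Hom B Y) : Prop :=
  forall (Z : C) (f : Hom A Z) (g : Hom B Z),
    exists! h : Hom Y Z, h \oc s = f /\ h \oc t = g.

Record Coproducts (C : Category) := {
  csum : C -> C -> C;
  cinl : forall A B, Hom A (csum A B);
  cinr : forall A B, Hom B (csum A B);
  copair : forall A B Z, Hom A Z -> Hom B Z -> Hom (csum A B) Z;
  copair_inl : forall A B Z (f : Hom A Z) (g : Hom B Z),
    copair f g \oc cinl A B = f;
  copair_inr : forall A B Z (f : Hom A Z) (g : Hom B Z),
    copair f g \oc cinr A B = g;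
  copair_uniq : forall A B Z (h : Hom (csum A B) Z),
    h = copair (h \oc cinl A B) (h \oc cinr A B) }.

Arguments csum {C} c A B.
Arguments cinl {C} c A B.
Arguments cinr {C} c A B.
Arguments copair {C} c {A B Z} f g.

Record Summand (C : Category) (Y : C) := {
  sdom : C;
  sinj : Hom sdom Y;
  scompl_dom : C;
  scompl : Hom scompl_dom Y;
  summandP : is_coproduct sinj scompl }.

Arguments sdom {C Y} s.
Arguments sinj {C Y} s.

Lemma cinr_is_coproduct (C : Category) (P : Coproducts C) (A B : C) :
  is_coproduct (cinr P A B) (cinl P A B).
Proof.
  intros Z f g. exists (copair P g f). split.
  - split; [apply copair_inr | apply copair_inl].
  - intros h [<- <-]. symmetry. apply copair_uniq.
Qed.

Definition inr_summand (C : Category) (P : Coproducts C) (A B : C) :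
    Summand (csum P A B) :=
  {| sdom := B; sinj := cinr P A B;
     scompl_dom := A; scompl := cinl P A B;
     summandP := @cinr_is_coproduct C P A B |}.

(* Monads in Kleisli (extension) form. *)
Record Monad (C : Category) := {
  TT :> C -> C;
  eta : forall A, Hom A (TT A);
  lift : forall A B, Hom A (TT B) -> Hom (TT A) (TT B);
  lift_eta : forall A, lift (eta A) = idm (TT A);
  lift_unit : forall A B (f : Hom A (TT B)), lift f \oc eta A = f;
  lift_lift : forall A B D (g : Hom B (TT D)) (f : Hom A (TT B)),
    lift g \oc lift f = lift (lift g \oc f) }.

Arguments eta {C} m A.
Arguments lift {C} m {A B} f.

Definition fmap (C : Category) (T : Monad C) (A B : C) (f : Hom A B) :
    Hom (T A) (T B) :=
  lift T (eta T B \oc f).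

Arguments fmap {C} T {A B} f.

Definition GuardRel (C : Category) (T : Monad C) :=
  forall (X Y : C), Summand Y -> Hom X (T Y) -> Prop.

Section GuardedIterative.
Variables (C : Category) (P : Coproducts C) (T : Monad C) (G : GuardRel T).

Definition guard_trv : Prop :=
  forall (X Y Z : C) (f : Hom X (T Y)),
    G (inr_summand P Y Z) (fmap T (cinl P Y Z) \oc f).

Definition guard_par : Prop :=
  forall (X Y Z : C) (s : Summand Z) (f : Hom X (T Z)) (g : Hom Y (T Z)),
    G s f -> G s g -> G s (copair P f g).

Definition guard_cmp : Prop :=
  forall (X Y Z V : C) (s : Summand V)
    (f : Hom X (T (csum P Y Z))) (g : Hom Y (T V)) (h : Hom Z (T V)),
    G (inr_summand P Y Z) f -> G s g ->
    G s (lift T (copair P g h) \oc f).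

Definition guard_iter : Prop :=
  forall (X Y : C) (f : Hom X (T (csum P Y X))),
    G (inr_summand P Y X) f ->
    exists! fdag : Hom X (T Y), fdag = lift T (copair P (eta T Y) fdag) \oc f.

Definition guarded_iterative : Prop :=
  guard_trv /\ guard_par /\ guard_cmp /\ guard_iter.
End GuardedIterative.

Arguments guarded_iterative {C} P T G.

Definition cauchy_seq (M : Metric_Space) (u : nat -> Base M) : Prop :=
  forall eps, 0 < eps -> exists N, forall n m, (N <= n)%nat -> (N <= m)%nat ->
    dist M (u n) (u m) < eps.

Definition seq_lim (M : Metric_Space) (u : nat -> Base M) (l : Base M) : Prop :=
  forall eps, 0 < eps -> exists N, forall n, (N <= n)%nat ->
    dist M (u n) l < eps.

Record CbUMet := {
  space :> Metric_Space;
  dist_le1 : forall x y : Base space, dist space x y <= 1;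
  dist_ultra : forall x y z : Base space,
    dist space x z <= Rmax (dist space x y) (dist space y z);
  dist_complete : forall u : nat -> Base space,
    cauchy_seq u -> exists l, seq_lim u l }.

Record Nonexp (A B : CbUMet) := {
  nefun :> Base A -> Base B;
  nonexp : forall x y, dist B (nefun x) (nefun y) <= dist A x y }.

Lemma nonexp_ext (A B : CbUMet) (f g : Nonexp A B) :
  (forall x, f x = g x) -> f = g.
Proof.
  destruct f as [f pf], g as [g pg]; simpl; intros E.
  assert (f = g) as -> by (apply functional_extensionality; exact E).
  f_equal. apply proof_irrelevance.
Qed.

Definition nonexp_id (A : CbUMet) : Nonexp A A :=
  {| nefun := fun x => x; nonexp := fun x y => Rle_refl _ |}.

Definition nonexp_cmp (A B D : CbUMet) (g : Nonexp B D) (f : Nonexp A B) :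
    Nonexp A D :=
  {| nefun := fun x => g (f x);
     nonexp := fun x y => Rle_trans _ _ _ (nonexp g (f x) (f y)) (nonexp f x y) |}.

Definition CbUMet_cat : Category.
Proof.
  refine {| Ob := CbUMet; Hom := Nonexp; idm := nonexp_id; cmp := nonexp_cmp |};
  intros; apply nonexp_ext; reflexivity.
Defined.

Lemma ultra_tri (X : Type) (d : X -> X -> R) :
  (forall x y, d x y >= 0) ->
  (forall x y z, d x z <= Rmax (d x y) (d y z)) ->
  forall x y z, d x y <= d x z + d z y.
Proof.
  intros p u x y z. specialize (u x z y).
  pose proof (p x z). pose proof (p z y).
  revert u. unfold Rmax. destruct Rle_dec; lra.
Qed.

Section Sum.
Variables A B : CbUMet.

Definition sum_dist (u v : Base A + Base B) : R :=
  match u, v with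
  | inl x, inl y => dist A x y
  | inr x, inr y => dist B x y
  | _, _ => 1
  end.

Lemma sum_dist_pos u v : sum_dist u v >= 0.
Proof. destruct u, v; simpl; try apply dist_pos; lra. Qed.

Lemma sum_dist_sym u v : sum_dist u v = sum_dist v u.
Proof. destruct u, v; simpl; try apply dist_sym; lra. Qed.

Lemma sum_dist_refl u v : sum_dist u v = 0 <-> u = v.
Proof.
  destruct u, v; simpl; try rewrite dist_refl;
  split; intro H; try congruence; lra.
Qed.

Lemma sum_dist_le1 u v : sum_dist u v <= 1.
Proof. destruct u, v; simpl; try apply dist_le1; lra. Qed.

Lemma sum_dist_ultra u v w :
  sum_dist u w <= Rmax (sum_dist u v) (sum_dist v w).
Proof.
  destruct u as [x|x], v as [y|y], w as [z|z]; simpl; try apply dist_ultra;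
  try (apply Rle_trans with 1; [first [apply dist_le1 | apply Rle_refl] |]);
  first [apply Rmax_l | apply Rmax_r].
Qed.

Definition sum_space : Metric_Space :=
  {| Base := Base A + Base B; dist := sum_dist;
     dist_pos := sum_dist_pos; dist_sym := sum_dist_sym;
     dist_refl := sum_dist_refl;
     dist_tri := ultra_tri sum_dist_pos sum_dist_ultra |}.

Lemma sum_complete (u : nat -> Base sum_space) :
  cauchy_seq u -> exists l, seq_lim u l.
Proof.
  intros Cu. destruct (Cu 1 Rlt_0_1) as [N HN]. simpl in *.
  destruct (u N) as [x0|x0] eqn:EN.
  - set (v := fun n => match u (N + n)%nat with inl y => y | inr _ => x0 end).
    assert (Hv : forall n, u (N + n)%nat = inl (v n)).
    { intros n. unfold v. specialize (HN N (N + n)%nat).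
      rewrite EN in HN. destruct (u (N + n)%nat); [reflexivity|].
      simpl in HN. exfalso. apply (Rlt_irrefl 1). apply HN; lia. }
    destruct (@dist_complete A v) as [l Hl].
    { intros e He. destruct (Cu e He) as [M HM]. exists M. intros n m Hn Hm.
      specialize (HM (N + n)%nat (N + m)%nat). simpl in HM.
      rewrite !Hv in HM. apply HM; lia. }
    exists (inl l). intros e He. destruct (Hl e He) as [M HM].
    exists (N + M)%nat. intros n Hn. replace n with (N + (n - N))%nat by lia.
    rewrite Hv. simpl. apply HM. lia.
  - set (v := fun n => match u (N + n)%nat with inr y => y | inl _ => x0 end).
    assert (Hv : forall n, u (N + n)%nat = inr (v n)).
    { intros n. unfold v. specialize (HN N (N + n)%nat).
      rewrite EN in HN. destruct (u (N + n)%nat); [|reflexivity].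
      simpl in HN. exfalso. apply (Rlt_irrefl 1). apply HN; lia. }
    destruct (@dist_complete B v) as [l Hl].
    { intros e He. destruct (Cu e He) as [M HM]. exists M. intros n m Hn Hm.
      specialize (HM (N + n)%nat (N + m)%nat). simpl in HM.
      rewrite !Hv in HM. apply HM; lia. }
    exists (inr l). intros e He. destruct (Hl e He) as [M HM].
    exists (N + M)%nat. intros n Hn. replace n with (N + (n - N))%nat by lia.
    rewrite Hv. simpl. apply HM. lia.
Qed.

Definition sum_met : CbUMet :=
  {| space := sum_space; dist_le1 := sum_dist_le1;
     dist_ultra := sum_dist_ultra; dist_complete := sum_complete |}.

Definition sum_inl : Nonexp A sum_met :=
  @Build_Nonexp A sum_met (fun x => inl x) (fun x y => Rle_refl _).

Definition sum_inr : Nonexp B sum_met :=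
  @Build_Nonexp B sum_met (fun x => inr x) (fun x y => Rle_refl _).

Lemma sum_copair_nonexp (Z : CbUMet) (f : Nonexp A Z) (g : Nonexp B Z)
    (u v : Base sum_met) :
  let h := fun w : Base A + Base B => match w with inl x => f x | inr y => g y end in
  dist Z (h u) (h v) <= dist sum_met u v.
Proof.
  destruct u, v; simpl; first [apply nonexp | apply dist_le1].
Qed.

Definition sum_copair (Z : CbUMet) (f : Nonexp A Z) (g : Nonexp B Z) :
    Nonexp sum_met Z :=
  @Build_Nonexp sum_met Z
    (fun w : Base A + Base B => match w with inl x => f x | inr y => g y end)
    (sum_copair_nonexp f g).
End Sum.

Definition CbUMet_coprod : Coproducts CbUMet_cat.
Proof.
  refine (@Build_Coproducts CbUMet_cat sum_met sum_inl sum_inr sum_copair _ _ _);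
  intros; apply nonexp_ext; intro w; try reflexivity.
  destruct w; reflexivity.
Defined.

(* [At x k] is the pair (x, k), [Infty] the added point. *)
Inductive lift_car (A : Type) := At (x : A) (k : nat) | Infty.

Arguments At {A} x k.
Arguments Infty {A}.

Lemma half_pos k : 0 < (1/2)^k.
Proof. apply pow_lt; lra. Qed.

Lemma half_le k t : (k <= t)%nat -> (1/2)^t <= (1/2)^k.
Proof.
  intros H. replace t with (k + (t - k))%nat by lia. rewrite pow_add.
  pose proof (half_pos k). assert ((1/2)^(t - k) <= 1).
  { apply Rle_trans with (1^(t - k)); [apply pow_incr; lra | rewrite pow1; lra]. }
  nra.
Qed.

Lemma half_scale_le k d : d <= 1 -> (1/2)^k * d <= (1/2)^k.
Proof. intros. pose proof (half_pos k). nra. Qed.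

Section Lift.
Variable A : CbUMet.

Definition lift_dist (u v : lift_car (Base A)) : R :=
  match u, v with
  | Infty, Infty => 0
  | At _ k, Infty => (1/2)^k
  | Infty, At _ k => (1/2)^k
  | At x k, At y t =>
      if Nat.eq_dec k t then (1/2)^k * dist A x y else (1/2)^(Nat.min k t)
  end.

Lemma lift_dist_pos u v : lift_dist u v >= 0.
Proof.
  destruct u as [x k|], v as [y t|]; simpl; try destruct Nat.eq_dec;
  try (left; apply half_pos); try apply Rge_refl.
  pose proof (half_pos k). pose proof (dist_pos A x y). nra.
Qed.

Lemma lift_dist_sym u v : lift_dist u v = lift_dist v u.
Proof.
  destruct u as [x k|], v as [y t|]; simpl; try reflexivity.
  destruct (Nat.eq_dec k t), (Nat.eq_dec t k); subst; try congruence.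
  - rewrite dist_sym. reflexivity.
  - rewrite Nat.min_comm. reflexivity.
Qed.

Lemma lift_dist_refl u v : lift_dist u v = 0 <-> u = v.
Proof.
  destruct u as [x k|], v as [y t|]; simpl; try destruct Nat.eq_dec.
  - subst t. pose proof (half_pos k). split; intro H0.
    + f_equal. apply (dist_refl A). nra.
    + injection H0 as ->. rewrite (proj2 (dist_refl A y y) eq_refl). lra.
  - pose proof (half_pos (Nat.min k t)). split; intro H0; [lra | congruence].
  - pose proof (half_pos k). split; intro; [lra | congruence].
  - pose proof (half_pos t). split; intro; [lra | congruence].
  - tauto.
Qed.

Lemma lift_dist_le1 u v : lift_dist u v <= 1.
Proof.
  assert (h1 : forall k, (1/2)^k <= 1) by (intro k; apply (@half_le 0 k); lia).
  destruct u as [x k|], v as [y t|]; simpl; try destruct Nat.eq_dec;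
  try apply h1; try lra.
  apply Rle_trans with (2 := h1 k). apply half_scale_le, dist_le1.
Qed.

Lemma lift_dist_ultra u v w :
  lift_dist u w <= Rmax (lift_dist u v) (lift_dist v w).
Proof.
  destruct u as [x i|], v as [y j|], w as [z k|]; simpl;
  repeat match goal with |- context [Nat.eq_dec ?a ?b] =>
    destruct (Nat.eq_dec a b); try subst; try congruence end.
  1: {
    rewrite RmaxRmult by (left; apply half_pos).
    apply Rmult_le_compat_l; [left; apply half_pos | apply dist_ultra]. }
  all: try (apply Rle_trans with (1 := half_scale_le _ (dist_le1 _ _))).
  all: try (apply Rle_trans with (2 := Rmax_l _ _); first
              [apply Rle_refl | apply half_le; lia | left; apply half_pos]).
  all: try (apply Rle_trans with (2 := Rmax_r _ _); first
              [apply Rle_refl | apply half_le; lia | left; apply half_pos]).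
  all: match goal with |- context [Nat.min ?a ?b] =>
         destruct (le_lt_dec a b) end;
       first [ apply Rle_trans with (2 := Rmax_l _ _); apply half_le; lia
             | apply Rle_trans with (2 := Rmax_r _ _); apply half_le; lia ].
Qed.

Definition lift_space : Metric_Space :=
  {| Base := lift_car (Base A); dist := lift_dist;
     dist_pos := lift_dist_pos; dist_sym := lift_dist_sym;
     dist_refl := lift_dist_refl;
     dist_tri := ultra_tri lift_dist_pos lift_dist_ultra |}.

Lemma lift_complete (u : nat -> Base lift_space) :
  cauchy_seq u -> exists l, seq_lim u l.
Proof.
  intros Cu. destruct (classic (seq_lim u (Infty : Base lift_space))) as [H|H].
  { exists Infty. exact H. }
  apply not_all_ex_not in H. destruct H as [e0 H].
  apply imply_to_and in H. destruct H as [He0 H].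
  destruct (Cu e0 He0) as [N HN].
  apply not_ex_all_not with (n := N) in H.
  apply not_all_ex_not in H. destruct H as [n0 H].
  apply imply_to_and in H. destruct H as [Hn0 H]. simpl in *.
  destruct (u n0) as [x0 k|] eqn:E0; simpl in H; [|lra].
  set (v := fun n => match u (N + n)%nat with At y _ => y | Infty => x0 end).
  assert (Hv : forall n, u (N + n)%nat = At (v n) k).
  { intros n. unfold v. specialize (HN n0 (N + n)%nat Hn0 ltac:(lia)).
    rewrite E0 in HN. destruct (u (N + n)%nat) as [y t|]; simpl in HN; [|lra].
    destruct Nat.eq_dec; [congruence|].
    pose proof (@half_le (Nat.min k t) k ltac:(lia)). lra. }
  pose proof (half_pos k) as hk.
  destruct (@dist_complete A v) as [l Hl].
  { intros e He. destruct (Cu ((1/2)^k * e)) as [M HM].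
    { apply Rmult_lt_0_compat; assumption. }
    exists M. intros n m Hn Hm.
    specialize (HM (N + n)%nat (N + m)%nat ltac:(lia) ltac:(lia)). simpl in HM.
    rewrite !Hv in HM. simpl in HM. destruct Nat.eq_dec; [|congruence].
    apply Rmult_lt_reg_l in HM; assumption. }
  exists (At l k). intros e He. destruct (Hl e He) as [M HM].
  exists (N + M)%nat. intros n Hn. replace n with (N + (n - N))%nat by lia.
  simpl. rewrite Hv. simpl. destruct Nat.eq_dec; [|congruence].
  specialize (HM (n - N)%nat ltac:(lia)).
  pose proof (dist_pos A (v (n - N)%nat) l).
  pose proof (@half_le 0 k ltac:(lia)). simpl in *. nra.
Qed.

Definition lift_met : CbUMet :=
  {| space := lift_space; dist_le1 := lift_dist_le1;
     dist_ultra := lift_dist_ultra; dist_complete := lift_complete |}.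

Lemma lift_eta_nonexp (x y : Base A) :
  dist lift_met (At x 0) (At y 0) <= dist A x y.
Proof. simpl. lra. Qed.

Definition esc_eta : Nonexp A lift_met :=
  @Build_Nonexp A lift_met (fun x => At x 0) lift_eta_nonexp.
End Lift.

Section Kleisli.
Variables (A B : CbUMet) (f : Nonexp A (lift_met B)).

Definition esc_lift_fun (u : lift_car (Base A)) : lift_car (Base B) :=
  match u with
  | At a k => match f a with At b t => At b (k + t) | Infty => Infty end
  | Infty => Infty
  end.

Lemma esc_lift_Infty u :
  lift_dist (esc_lift_fun u) (Infty : lift_car (Base B)) <= lift_dist u Infty.
Proof.
  destruct u as [a k|]; simpl; [|lra].
  destruct (f a) as [b t|]; simpl.
  - apply half_le. lia.
  - left. apply half_pos.
Qed.

Lemma esc_lift_nonexp (u v : Base (lift_met A)) :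
  dist (lift_met B) (esc_lift_fun u) (esc_lift_fun v) <= dist (lift_met A) u v.
Proof.
  destruct u as [x k|]; [destruct v as [y t|]|].
  - destruct (Nat.eq_dec k t) as [<-|n].
    + assert (E : dist (lift_met A) (At x k) (At y k) = (1/2)^k * dist A x y).
      { simpl. destruct Nat.eq_dec; [reflexivity | congruence]. }
      rewrite E. pose proof (half_pos k).
      apply Rle_trans with ((1/2)^k * dist (lift_met B) (f x) (f y));
        [|apply Rmult_le_compat_l; [lra | apply nonexp]].
      right. simpl.
      destruct (f x) as [b i|], (f y) as [c j|]; simpl; try (rewrite pow_add; lra);
        try lra.
      destruct (Nat.eq_dec (k + i) (k + j)), (Nat.eq_dec i j); try lia.
      * rewrite pow_add. lra.
      * rewrite <- pow_add. f_equal. lia.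
    + apply Rle_trans with (1 := dist_ultra (c := lift_met B) _ Infty _).
      apply Rmax_lub.
      * apply Rle_trans with (1 := esc_lift_Infty _). simpl.
        destruct Nat.eq_dec; [congruence|]. apply half_le. lia.
      * rewrite dist_sym. apply Rle_trans with (1 := esc_lift_Infty _). simpl.
        destruct Nat.eq_dec; [congruence|]. apply half_le. lia.
  - apply esc_lift_Infty.
  - rewrite dist_sym, (dist_sym (lift_met A)). apply esc_lift_Infty.
Qed.

Definition esc_lift : Nonexp (lift_met A) (lift_met B) :=
  @Build_Nonexp (lift_met A) (lift_met B) esc_lift_fun esc_lift_nonexp.
End Kleisli.

Definition escardo_monad : Monad CbUMet_cat.
Proof.
  refine (@Build_Monad CbUMet_cat lift_met esc_eta esc_lift _ _ _).
  - intros A. apply nonexp_ext. intros [a k|]; simpl; [|reflexivity].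
    f_equal. lia.
  - intros A B f. apply nonexp_ext. intros a; simpl.
    destruct (nefun f a); reflexivity.
  - intros A B D g f. apply nonexp_ext. intros [a k|]; simpl; [|reflexivity].
    destruct (nefun f a) as [b t|]; simpl; [|reflexivity].
    destruct (nefun g b) as [c s|]; simpl; [|reflexivity].
    f_equal. lia.
Defined.

Definition escardo_guarded : GuardRel escardo_monad :=
  fun (X Y : CbUMet) (s : @Summand CbUMet_cat Y) (f : Nonexp X (lift_met Y)) =>
    forall (x : Base X) (y : Base (@sdom CbUMet_cat Y s)) (k : nat),
      f x = At (@nefun (sdom s) Y (sinj s) y) k -> (0 < k)%nat.

(* Main.v *)
Require Import Defs.
From Stdlib Require Import Reals Lia Arith Classical ClassicalEpsilon.

(** The three closure rules are read off the formula for Kleisli lifting, where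
    delays add up.  For iteration, let [Phi d = [eta, d]^* f] and start from the
    constant map at infinity.  A finite value reached by some approximant
    [Phi^n] persists in all later ones, so at every point the approximants are
    eventually constant; their pointwise limit is therefore nonexpansive and a
    fixpoint of [Phi].  Guardedness gives uniqueness: each unfolding through the
    right summand strictly lowers the remaining delay, so by strong induction on
    the delay any finite value of one fixpoint is a value of every other. *)

Set Implicit Arguments.
Unset Strict Implicit.

Lemma escardo_guard_trv :
  guard_trv CbUMet_coprod escardo_guarded.
Proof.
  intros X Y Z f x z k. change (Nonexp X (lift_met Y)) in f. simpl.
  destruct (nefun f x) as [y t|]; simpl; intros E; discriminate E.
Qed.

Lemma escardo_guard_par :
  guard_par CbUMet_coprod escardo_guarded.
Proof.
  intros X Y Z s f g Gf Gg [x|y] z k; [apply Gf | apply Gg].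
Qed.

Lemma escardo_guard_cmp :
  guard_cmp CbUMet_coprod escardo_guarded.
Proof.
  intros X Y Z V s f g h Gf Gg x v k.
  change (Nonexp X (lift_met (sum_met Y Z))) in f.
  change (Nonexp Y (lift_met V)) in g. change (Nonexp Z (lift_met V)) in h.
  simpl.
  destruct (nefun f x) as [[y|z] i|] eqn:Ef; simpl; [| |congruence].
  (* The total delay is [i + j]: on the left [j] is positive because [g] is guarded, on the right
     [i] is positive because [f] is. *)
  - destruct (nefun g y) as [w j|] eqn:Eg; [|congruence].
    intros E. injection E as -> <-. specialize (Gg y v j Eg). lia.
  - specialize (Gf x z i Ef).
    destruct (nefun h z) as [w j|]; [|congruence].
    intros E. injection E as _ <-. lia.
Qed.

Section Iteration.
Variables (X Y : CbUMet) (f : Nonexp X (lift_met (sum_met Y X))).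

(** This is the operator [Phi], whose fixpoints are the solutions of the iteration equation. *)
Definition iter_step (d : Nonexp X (lift_met Y)) : Nonexp X (lift_met Y) :=
  nonexp_cmp (esc_lift (sum_copair (esc_eta Y) d)) f.

Lemma iter_stepE d x :
  iter_step d x =
  match f x with
  | At (inl y) k => At y k
  | At (inr x') k =>
      match d x' with At y t => At y (k + t) | Infty => Infty end
  | Infty => Infty
  end.
Proof.
  simpl. destruct (nefun f x) as [[y|x'] k|]; simpl; try reflexivity.
  f_equal. lia.
Qed.

Lemma infty_nonexp (x x' : Base X) :
  (dist (lift_met Y) (Infty) (Infty) <= dist X x x')%R.
Proof. apply Rge_le, dist_pos. Qed.

Fixpoint iter_approx (n : nat) : Nonexp X (lift_met Y) :=
  match n with
  | O => @Build_Nonexp X (lift_met Y) (fun _ => Infty) infty_nonexp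
  | S n => iter_step (iter_approx n)
  end.

Lemma iter_approx_succ n x y k :
  iter_approx n x = At y k -> iter_approx (S n) x = At y k.
Proof.
  revert x y k. induction n as [|n IH]; intros x y k; [discriminate|].
  change (iter_approx (S n)) with (iter_step (iter_approx n)) at 1.
  change (iter_approx (S (S n))) with (iter_step (iter_approx (S n))).
  rewrite !iter_stepE. destruct (f x) as [[z|x'] i|]; try tauto.
  destruct (iter_approx n x') as [z j|] eqn:E; [|discriminate].
  rewrite (IH _ _ _ E). tauto.
Qed.

Lemma iter_approx_eventually_constant x :
  exists v, exists N, forall n, (N <= n)%nat -> iter_approx n x = v.
Proof.
  (* Whether a finite value ever appears is undecidable, hence the classical split. *)
  destruct (classic (forall n, iter_approx n x = Infty)) as [H|H].
  - exists (Infty), 0%nat. auto.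
  - apply not_all_ex_not in H. destruct H as [N H].
    exists (iter_approx N x), N. intros n Hn.
    destruct (iter_approx N x) as [y k|] eqn:E; [clear H|congruence].
    induction Hn; [exact E | now apply iter_approx_succ].
Qed.

(** Description turns the existence of eventual values into a function. *)
Definition iter_lim (x : Base X) : lift_car (Base Y) :=
  proj1_sig (constructive_indefinite_description _
    (iter_approx_eventually_constant x)).

Lemma iter_limP x :
  exists N, forall n, (N <= n)%nat -> iter_approx n x = iter_lim x.
Proof. unfold iter_lim. apply proj2_sig. Qed.

Lemma iter_lim_nonexp x x' :
  (dist (lift_met Y) (iter_lim x) (iter_lim x') <= dist X x x')%R.
Proof.
  destruct (iter_limP x) as [N HN], (iter_limP x') as [M HM].
  (* At a common late index both limits are values of one nonexpansive approximant. *)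
  rewrite <- (HN (N + M)%nat), <- (HM (N + M)%nat) by lia. apply nonexp.
Qed.

Definition iter_dagger : Nonexp X (lift_met Y) :=
  @Build_Nonexp X (lift_met Y) iter_lim iter_lim_nonexp.

Lemma iter_dagger_fix : iter_dagger = iter_step iter_dagger.
Proof.
  apply nonexp_ext. intros x. rewrite iter_stepE.
  change (nefun iter_dagger) with iter_lim.
  destruct (iter_limP x) as [N HN].
  destruct (f x) as [[y|x'] k|] eqn:E.
  - rewrite <- (HN (S N)) by lia. simpl iter_approx. now rewrite iter_stepE, E.
  - destruct (iter_limP x') as [M HM].
    (* The indices differ by one because unfolding at [x] consults the previous approximant at
       [x']. *)
    rewrite <- (HN (S (N + M))), <- (HM (N + M)%nat) by lia.
    simpl iter_approx. now rewrite iter_stepE, E.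
  - rewrite <- (HN (S N)) by lia. simpl iter_approx. now rewrite iter_stepE, E.
Qed.

Hypothesis f_guarded : forall x x' k, f x = At (inr x') k -> (0 < k)%nat.

Lemma iter_fix_finite g h x y k :
  g = iter_step g -> h = iter_step h -> g x = At y k -> h x = At y k.
Proof.
  intros Hg Hh. revert x. induction k as [k IH] using lt_wf_ind. intros x.
  rewrite Hg, Hh, !iter_stepE.
  destruct (f x) as [[z|x'] i|] eqn:E; try tauto.
  apply f_guarded in E.
  destruct (g x') as [z j|] eqn:Eg; [|discriminate].
  intros Ez. injection Ez as -> <-. now rewrite (IH j ltac:(lia) _ Eg).
Qed.

Lemma iter_fix_unique g h : g = iter_step g -> h = iter_step h -> g = h.
Proof.
  intros Hg Hh. apply nonexp_ext. intros x.
  destruct (g x) as [y k|] eqn:Eg.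
  - symmetry. now apply (iter_fix_finite Hg Hh).
  (* Exchanging the two fixpoints excludes a finite value of [h] where [g] is infinite. *)
  - destruct (h x) as [y k|] eqn:Eh; [|reflexivity].
    apply (iter_fix_finite Hh Hg) in Eh. congruence.
Qed.
End Iteration.

Lemma escardo_guard_iter :
  guard_iter CbUMet_coprod escardo_guarded.
Proof.
  intros X Y f Gf. exists (iter_dagger f). split.
  - exact (iter_dagger_fix f).
  - intros h Hh.
    exact (iter_fix_unique Gf (iter_dagger_fix f) Hh).
Qed.

Theorem theoremA1 :
  guarded_iterative CbUMet_coprod escardo_monad escardo_guarded.
Proof.
  exact (conj escardo_guard_trv (conj escardo_guard_par
    (conj escardo_guard_cmp escardo_guard_iter))).
Qed.
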